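(* Let $X$ and $Y$ be infinite locally compact $\sigma$-compact Tychonoff spaces. Then $C_k(X\times Y)$ contains a complemented copy of $\mathbb{R}^\omega$ or a complemented copy of the Banach space $c_0$.
   Context: All topological spaces are Tychonoff (completely regular and Hausdorff). A Tychonoff space is $\sigma$-compact if it is covered by an increasing sequence of compact subsets. $C_k(Z)$ is the space of all continuous real-valued functions on $Z$ with the compact-open topology. $\mathbb{R}^\omega$ carries the product topology; $c_0$ is the Banach space of real sequences converging to $0$ with the supremum norm. A locally convex space $G$ contains a complemented copy of $F$ if there are closed linear subspaces $G_1,G_2$ of $G$ with $G=G_1\oplus G_2$ algebraically, $G_1$ linearly homeomorphic to $F$, and the natural projection of $G$ onto $G_1$ continuous. *)

(* Defs.v *)
From HB Require Import structures.
From mathcomp Require Import all_boot all_order all_algebra.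
From mathcomp Require Import all_classical all_reals all_analysis.
From mathcomp Require Import ring.

Set Implicit Arguments.
Unset Strict Implicit.
Unset Printing Implicit Defensive.

Import Order.TTheory GRing.Theory Num.Theory.
Import numFieldNormedType.Exports.

Local Open Scope classical_set_scope.
Local Open Scope ring_scope.

Definition tychonoff_space (T : topologicalType) : Prop :=
  completely_regular_space T /\ hausdorff_space T.

Definition sigma_compact (T : topologicalType) : Prop :=
  exists K : nat -> set T,
    [/\ forall n, compact (K n),
        forall n, K n `<=` K n.+1 &
        \bigcup_n K n = [set: T]].

(* A topology given by uniform convergence, on the sets of a family fam, of
   the scalar functions z |-> ev z x is locally convex. *)
Section locally_convex_of_seminorms.
Context (R : realType) (E : preTopologicalLmodType R) (Z : Type).
Context (ev : Z -> E -> R) (fam : set (set Z)).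
Hypothesis evD : forall z x y, ev z (x + y) = ev z x + ev z y.
Hypothesis evZ : forall z k x, ev z (k *: x) = k * ev z x.
Hypothesis fam_bounded : forall A x, fam A ->
  exists M, forall z, A z -> `|ev z x| <= M.
Hypothesis nbhs_fam : forall (x : E) (U : set E), nbhs x U <->
  exists A e, [/\ fam A, 0 < e &
    [set y | forall z, A z -> `|ev z x - ev z y| < e] `<=` U].

Lemma seminorms_add_continuous : continuous (fun x : E * E => x.1 + x.2).
Proof.
move=> [x y] U /= /nbhs_fam[A [e [fA e0 AU]]].
exists ([set t | forall z, A z -> `|ev z x - ev z t| < e / 2],
        [set t | forall z, A z -> `|ev z y - ev z t| < e / 2]).
  by split; apply/nbhs_fam; exists A, (e / 2); split => //; rewrite divr_gt0.
move=> [s t] /= [xs yt]; apply: AU => z Az; rewrite !evD opprD addrACA.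
rewrite (le_lt_trans (ler_normD _ _))// (splitr e).
by rewrite ltrD ?xs ?yt.
Qed.

Lemma seminorms_scale_continuous :
  continuous (fun z : R^o * E => z.1 *: z.2).
Proof.
move=> [k x] U /= /nbhs_fam[A [e [fA e0 AU]]].
have [M AM] := fam_bounded x fA.
pose N := `|M| + `|k| + 1.
have N0 : 0 < N by rewrite ltr_wpDl// addr_ge0.
pose d := Num.min 1 (e / 2 / N).
have d0 : 0 < d by rewrite lt_min ltr01 !divr_gt0.
exists (ball (k : R^o) d, [set t | forall z, A z -> `|ev z x - ev z t| < d]).
  split; first exact: nbhsx_ballx.
  by apply/nbhs_fam; exists A, d; split.
move=> [l y] /= [kl xy]; apply: AU => z Az; rewrite !evZ.
have {}kl : `|k - l| < d by [].
have {}xy := xy z Az.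
have xM : `|ev z x| <= `|M| by rewrite (le_trans (AM _ Az))// ler_norm.
have lk : `|l| <= `|k| + 1.
  rewrite -[l](subKr k) (le_trans (ler_normB _ _))// lerD2l.
  by rewrite (le_trans (ltW kl))// ge_min lexx.
rewrite (_ : k * _ - _ = (k - l) * ev z x + l * (ev z x - ev z y)); last first.
  by rewrite mulrBl mulrBr addrA subrK.
rewrite (le_lt_trans (ler_normD _ _))// !normrM.
have dN : d * N <= e / 2 by rewrite -ler_pdivlMr// ge_min lexx orbT.
have e2e : e / 2 < e by rewrite ltr_pdivrMr// ltr_pMr// ltr1n.
apply: le_lt_trans e2e; apply: le_trans dN.
rewrite /N -addrA mulrDr lerD//.
  by rewrite ler_pM// ltW.
by rewrite mulrC ler_pM// ltW.
Qed.

Lemma seminorms_locally_convex :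
  exists2 B : set_system E, (forall b, b \in B -> convex_set b) & basis B.
Proof.
pose b (x : E) (A : set Z) (e : R) := [set y | exists2 d, d < e &
  forall z, A z -> `|ev z x - ev z y| <= d].
exists [set U | exists x A e, [/\ fam A, 0 < e & U = b x A e]].
  move=> _ /[!inE] -[x [A [e [fA e0 ->]]]]; apply/convex_setW => s t.
  rewrite !inE => -[d1 d1e xs] [d2 d2e xt] l l0 l1; rewrite inE.
  exists (Num.max d1 d2); first by rewrite gt_max d1e.
  move=> z Az; set p := l%:num in l0 l1.
  have p0 : 0 <= p by exact: ltW.
  have p1 : 0 <= 1 - p by rewrite subr_ge0 ltW.
  rewrite [X in _ - X](_ : _ = ev z (p *: s + (1 - p) *: t))//.
  rewrite evD !evZ.
  have -> : ev z x - (p * ev z s + (1 - p) * ev z t) =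
      p * (ev z x - ev z s) + (1 - p) * (ev z x - ev z t) by ring.
  rewrite (le_trans (ler_normD _ _))// !normrM (ger0_norm p0) (ger0_norm p1).
  rewrite -[leRHS]mul1r -{2}(subrKC p 1) [leRHS]mulrDl lerD//.
    by rewrite ler_wpM2l// le_max xs.
  by rewrite ler_wpM2l// le_max xt ?orbT.
split.
  move=> _ [x [A [e [fA e0 ->]]]]; rewrite openE => y [d de xy].
  apply/nbhs_fam; exists A, ((e - d) / 2).
  have ed : 0 < e - d by rewrite subr_gt0.
  split; rewrite ?divr_gt0// => t /= yt; exists (d + (e - d) / 2).
    by rewrite -ltrBrDl ltr_pdivrMr// ltr_pMr// ltr1n.
  move=> z Az; rewrite -(subrK (ev z y) (ev z x)) -addrA.
  by rewrite (le_trans (ler_normD _ _))// lerD ?xy// ltW// yt.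
move=> x U /nbhs_fam[A [e [fA e0 AU]]]; exists (b x A e).
  split; first by exists x, A, e.
  by exists 0 => // z Az; rewrite subrr normr0.
by move=> y [d de xy]; apply: AU => z Az; rewrite (le_lt_trans (xy z Az)).
Qed.

End locally_convex_of_seminorms.

Section compact_open_space.
Context (Z : topologicalType) (R : realType).

(* C_k(Z), with values in R. *)
Definition Ck : Type := continuousType Z R.

Definition cts_pred : {pred Z -> R^o} := mem [set f : Z -> R | continuous f].

Let Ck_Sub (f : Z -> R^o) (fP : f \in cts_pred) : Ck :=
  mkcts (set_mem fP).

Let Ck_rect (K : Ck -> Type) :
  (forall f (fP : f \in cts_pred), K (Ck_Sub fP)) -> forall u : Ck, K u.
Proof.
move=> Ksub u; have cu : continuous u by exact: cts_fun.
have uP : (u : Z -> R^o) \in cts_pred by rewrite inE.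
suff -> : u = Ck_Sub uP by exact: Ksub.
exact/continuousEP.
Qed.

Let Ck_valK (f : Z -> R^o) (fP : f \in cts_pred) :
  (Ck_Sub fP : Z -> R^o) = f.
Proof. by []. Qed.

HB.instance Definition _ := isSub.Build (Z -> R^o) _ Ck Ck_rect Ck_valK.
HB.instance Definition _ := Choice.on Ck.

Let cts_submod_closed : submod_closed cts_pred.
Proof.
split; first by rewrite inE /=; exact: cst_continuous.
move=> k f g /[!inE] /= cf cg z.
by apply: (@cvgD _ R^o) ; [apply: cvgZr; exact: cf|exact: cg].
Qed.

HB.instance Definition _ := GRing.isSubmodClosed.Build R (Z -> R^o) cts_pred
  cts_submod_closed.
HB.instance Definition _ := [SubChoice_isSubLmodule of Ck by <:].

HB.instance Definition _ := Topological.copy Ck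
  (initial_topology (fun f : Ck => (f : {compact-open, Z -> R}))).

Lemma Ck_nbhsP (f : Ck) (U : set Ck) : nbhs f U <->
  exists A e, [/\ compact A, 0 < e &
    [set g : Ck | forall z, A z -> `|f z - g z| < e] `<=` U].
Proof.
have cf : continuous (f : Z -> R) by exact: cts_fun.
split.
  pose F : set_system Ck := filter_from
    [set Ae : set Z * R | compact Ae.1 /\ 0 < Ae.2]
    (fun Ae => [set g : Ck | forall z, Ae.1 z -> `|f z - g z| < Ae.2]).
  have FF : Filter F.
    apply: filter_from_filter; first by exists (set0, 1); split => //; exact: compact0.
    move=> [A d] [B e] [/= cA d0] [/= cB e0].
    exists (A `|` B, Num.min d e).
      by split; [exact: compactU|rewrite lt_min d0].
    move=> g /= fg; split => z Xz.
      by have := fg z (or_introl Xz); rewrite lt_min => /andP[].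
    by have := fg z (or_intror Xz); rewrite lt_min => /andP[].
  have cvgF : (fun g : Ck => (g : Z -> R)) @ F -->
      ((f : Z -> R) : {compact-open, Z -> R}).
    apply/compact_open_fam_compactP => //; apply/fam_cvgP => A cA W.
    move=> /uniform_nbhs[E [entE EW]].
    move: entE; rewrite -entourage_ballE => -[e /= e0 eE].
    exists (A, e) => // g /= fg; apply: EW => z Az; apply: eE => /=.
    by apply: fg.
  move=> [V [[W oW <-] Wf WU]].
  have /cvgF[[A e] [/= cA e0] AW] : nbhs ((f : Z -> R) : {compact-open, Z -> R}) W.
    exact: open_nbhs_nbhs.
  by exists A, e; split => // g fg; apply: WU; exact: AW.
move=> [A [e [cA e0 AU]]].
have /fam_cvgP/(_ _ cA) :
    {family compact, nbhs ((f : Z -> R) : {compact-open, Z -> R}) --> (f : Z -> R)}.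
  by apply/compact_open_fam_compactP.
move=> /(_ [set g | forall z, A z -> `|f z - g z| < e]).
have fA : nbhs ((f : Z -> R) : {uniform` A -> R})
    [set g | forall z, A z -> `|f z - g z| < e].
  apply/uniform_nbhs; exists [set xy | ball xy.1 e xy.2]; split.
    by rewrite -entourage_ballE; exists e.
  by move=> g /= fg z Az; exact: fg.
move=> /(_ fA); rewrite nbhsE => -[W [oW Wf] WA].
exists ((fun g : Ck => (g : Z -> R)) @^-1` W); split => //.
  by exists W.
by move=> g Wg; apply: AU; exact: WA.
Qed.

Let Ck_bounded (A : set Z) (f : Ck) : compact A ->
  exists M, forall z, A z -> `|f z| <= M.
Proof.
move=> cA; have cf : {within A, continuous (f : Z -> R^o)}.
  by apply: continuous_subspaceT; exact: cts_fun.
have /compact_bounded[M [_ MfA]] := continuous_compact cf cA.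
exists (M + 1) => z Az; apply: MfA; first by rewrite ltrDl.
by exists z.
Qed.

Let Ck_evD z (f g : Ck) : (f + g) z = f z + g z. Proof. by []. Qed.

Let Ck_evZ z k (f : Ck) : (k *: f) z = k * f z. Proof. by []. Qed.

HB.instance Definition _ := PreTopologicalLmod_isTvs.Build R Ck
  (seminorms_add_continuous Ck_evD Ck_nbhsP)
  (seminorms_scale_continuous Ck_evZ Ck_bounded Ck_nbhsP)
  (seminorms_locally_convex Ck_evD Ck_evZ Ck_nbhsP).
(* The factory above only yields the uniform structure. *)
HB.instance Definition _ := PreTopologicalNmodule_isTopologicalNmodule.Build
  Ck (seminorms_add_continuous Ck_evD Ck_nbhsP).
HB.instance Definition _ := TopologicalNmodule_isTopologicalLmodule.Build R
  Ck (seminorms_scale_continuous Ck_evZ Ck_bounded Ck_nbhsP).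
HB.instance Definition _ := Uniform_isTvs.Build R Ck
  (seminorms_locally_convex Ck_evD Ck_evZ Ck_nbhsP).

End compact_open_space.

Section product_space.
Context (R : realType).

Definition Romega : Type := {ptws nat -> R}.

HB.instance Definition _ := GRing.Lmodule.copy Romega (nat -> R^o).
HB.instance Definition _ := Uniform.copy Romega {ptws nat -> R}.

Let fam : set (set nat) := [set `I_n | n in [set: nat]].

Let Romega_nbhsP (x : Romega) (U : set Romega) : nbhs x U <->
  exists A e, [/\ fam A, 0 < e &
    [set y : Romega | forall i, A i -> `|x i - y i| < e] `<=` U].
Proof.
split.
  pose F : set_system (nat -> R) := filter_from
    [set ne : nat * R | 0 < ne.2]
    (fun ne => [set y | forall i, (i < ne.1)%N -> `|x i - y i| < ne.2]).
  have FF : Filter F.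
    apply: filter_from_filter; first by exists (0%N, 1) => /=.
    move=> [m d] [n e] /= d0 e0; exists (maxn m n, Num.min d e).
      by rewrite /= lt_min d0.
    move=> y /= xy; split => i im.
      by have := xy i; rewrite leq_max im lt_min => /(_ isT)/andP[].
    by have := xy i; rewrite leq_max im orbT lt_min => /(_ isT)/andP[].
  have cvgF : F --> (x : {ptws nat -> R}).
    apply/pointwise_cvgP => i; apply/cvgrPdist_lt => e e0.
    by exists (i.+1, e) => //= y /=; apply.
  by move=> /cvgF[[n e] /= e0 nU]; exists `I_n, e; split => //; exists n.
move=> [_ [e [[n _ <-] e0 nU]]].
have FF : Filter (nbhs (x : {ptws nat -> R})) by exact: nbhs_filter.
apply: (@filterS _ (nbhs (x : {ptws nat -> R})) _ _ _ nU).
elim: n {nU} => [|n ih]; first exact: filterE.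
have xn : nbhs (x : {ptws nat -> R}) [set y : nat -> R | `|x n - y n| < e].
  have : {ptws, nbhs (x : {ptws nat -> R}) --> x} by move=> ?.
  by move=> /pointwise_cvgP/(_ n)/cvgrPdist_lt/(_ _ e0).
apply: filterS (filterI ih xn) => y [xy xyn] i /=.
by rewrite ltnS leq_eqVlt => /predU1P[->//|]; exact: xy.
Qed.

Let Romega_bounded (A : set nat) (x : Romega) : fam A ->
  exists M, forall i, A i -> `|x i| <= M.
Proof.
move=> [n _ <-]; exists (\sum_(i < n) `|x i|) => i /= ni.
by rewrite (bigD1 (Ordinal ni))//= lerDl sumr_ge0.
Qed.

Let Romega_evD i (x y : Romega) : (x + y) i = x i + y i. Proof. by []. Qed.

Let Romega_evZ i k (x : Romega) : (k *: x) i = k * x i. Proof. by []. Qed.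

HB.instance Definition _ := PreTopologicalNmodule_isTopologicalNmodule.Build
  Romega (seminorms_add_continuous Romega_evD Romega_nbhsP).
HB.instance Definition _ := TopologicalNmodule_isTopologicalLmodule.Build R
  Romega (seminorms_scale_continuous Romega_evZ Romega_bounded Romega_nbhsP).
HB.instance Definition _ := Uniform_isTvs.Build R Romega
  (seminorms_locally_convex Romega_evD Romega_evZ Romega_nbhsP).

End product_space.

Section null_sequences.
Context (R : realType).

Definition null_seq : {pred nat -> R^o} :=
  mem [set u : nat -> R | u @ \oo --> (0 : R)].

Let null_seq_submod_closed : submod_closed null_seq.
Proof.
split; first by rewrite inE /=; exact: cvg_cst.
move=> k u v /[!inE] /= u0 v0.
by rewrite -(addr0 (0 : R)) -{1}(mulr0 k); apply: cvgD => //; exact: cvgMr.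
Qed.

HB.instance Definition _ := GRing.isSubmodClosed.Build R (nat -> R^o) null_seq
  null_seq_submod_closed.

Record c0 : Type := C0 {
  c0_seq :> nat -> R^o ;
  c0P : c0_seq \in null_seq }.

HB.instance Definition _ := [isSub for c0_seq].
HB.instance Definition _ := [Choice of c0 by <:].
HB.instance Definition _ := [SubChoice_isSubLmodule of c0 by <:].

Definition c0_norm (u : c0) : R := sup (range (fun n => `|u n|)).

Lemma c0_has_sup (u : c0) : has_sup (range (fun n => `|u n|)).
Proof.
split; first by exists `|u 0|, 0.
have /set_mem/= u0 := c0P u.
have /cvg_seq_bounded[M [_ Mu]] : cvgn (c0_seq u : R^nat).
  by apply/cvg_ex; exists 0.
by exists (M + 1) => _ [n _ <-]; apply: Mu => //; rewrite ltrDl.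
Qed.

Lemma c0_norm_ge (u : c0) n : `|u n| <= c0_norm u.
Proof. by apply: ub_le_sup; [case: (c0_has_sup u)|exists n]. Qed.

Lemma c0_norm_le (u : c0) M : (forall n, `|u n| <= M) -> c0_norm u <= M.
Proof.
move=> uM; apply: ge_sup; first by case: (c0_has_sup u).
by move=> _ [n _ <-].
Qed.

Let c0_normD (u v : c0) : c0_norm (u + v) <= c0_norm u + c0_norm v.
Proof.
apply: c0_norm_le => n; rewrite (le_trans (ler_normD _ _))//.
by rewrite lerD// c0_norm_ge.
Qed.

Let c0_normZ (k : R) (u : c0) : c0_norm (k *: u) = `|k| * c0_norm u.
Proof.
have H (l : R) (v : c0) : c0_norm (l *: v) <= `|l| * c0_norm v.
  apply: c0_norm_le => n; rewrite [leLHS](normrM l (v n)).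
  by rewrite ler_wpM2l// c0_norm_ge.
apply/le_anti; rewrite H/=.
have [->|k0] := eqVneq k 0.
  by rewrite normr0 mul0r; apply: le_trans (c0_norm_ge _ 0).
rewrite -ler_pdivlMl ?normr_gt0// -normfV.
by rewrite -{1}(scalerK k0 u).
Qed.

Let c0_norm_eq0 (u : c0) : c0_norm u = 0 -> u = 0.
Proof.
move=> u0; apply/val_inj/funext => n; apply/eqP.
by rewrite -[_ == _]normr_le0 -u0; exact: c0_norm_ge.
Qed.

HB.instance Definition _ :=
  Lmodule_isNormed.Build R c0 c0_normD c0_normZ c0_norm_eq0.

End null_sequences.

Section complemented_copies.
Context (R : realType).

Definition closed_linear_subspace (G : tvsType R) (H : set G) : Prop :=
  closed H /\ submod_closed (mem H).

Definition algebraic_direct_sum (G : tvsType R) (G1 G2 : set G) : Prop :=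
  forall x : G, exists! x12 : G * G,
    [/\ G1 x12.1, G2 x12.2 & x = x12.1 + x12.2].

(* f is the homeomorphism; its inverse is the restriction of g to H, so only
   the values of g on H matter. *)
Definition linearly_homeomorphic (F G : tvsType R) (H : set G) : Prop :=
  exists (f : {linear F -> G}) (g : G -> F),
    [/\ range f = H, cancel f g, continuous f & {within H, continuous g}].

Definition natural_projection (G : tvsType R) (G1 G2 : set G) (p : G -> G) :
    Prop :=
  forall x, G1 (p x) /\ G2 (x - p x).

Definition contains_complemented_copy (G F : tvsType R) : Prop :=
  exists G1 G2 : set G,
    [/\ closed_linear_subspace G1, closed_linear_subspace G2,
        algebraic_direct_sum G1 G2, linearly_homeomorphic F G1 &
        exists2 p : G -> G, natural_projection G1 G2 p & continuous p].

End complemented_copies.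

Arguments contains_complemented_copy R G F : clear implicits.

(* Main.v *)
Require Import Defs.
From HB Require Import structures.
From mathcomp Require Import all_boot all_order all_algebra.
From mathcomp Require Import all_classical all_reals all_analysis.
From mathcomp Require Import ring lra.

Set Implicit Arguments.
Unset Strict Implicit.
Unset Printing Implicit Defensive.

Import Order.TTheory GRing.Theory Num.Theory.
Import numFieldNormedType.Exports.

Local Open Scope classical_set_scope.
Local Open Scope ring_scope.

(** A complemented copy of F in G amounts to continuous linear maps T : F -> G
    and S : G -> F with S o T the identity: the copy is the range of T, its
    complement the kernel of S, the projection T o S
    (complemented_copy_of_section).  In both cases below T glues functions
    phi_n with pairwise disjoint supports, a |-> sum_n a_n phi_n, and S
    evaluates functionals mu_n such that mu_n (sum_m a_m phi_m) = a_n.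

    If one factor, say X, is not compact, it is exhausted by compact sets L_n,
    each inside the interior of the next, with points x_n in the interior of
    L_(n+1) but outside L_n (noncompact_exhaustion).  Bumps phi_n at x_n living
    in these shells form a locally finite family, so every scalar sequence can
    be glued, and with mu_n the evaluation at x_n one gets a complemented
    copy of R^omega (complemented_Romega).

    If both factors are compact, gluing needs a_n --> 0, and the difficulty is
    to find functionals of norm at most 1 that are weak* null, so that S takes
    its values in c_0, yet satisfy mu_n (phi_n) = 1.  Take disjoint bumps
    around points x_(n,s) of X, where s ranges over the sign vectors of length
    n + 1, and around points y_i of Y, and let mu_n be the average over s and
    i <= n of s_i f(x_(n,s), y_i).  The function phi_n that takes the value
    s_i at (x_(n,s), y_i) has mu_n (phi_n) = 1.  For f which does not depend on
    the first coordinate, mu_n f is small because for most sign vectors the sum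
    of n + 1 signs is of order the square root of n (rademacher_sum_norm).  By
    compactness the sections f(x, .) lie within e of finitely many of them
    (sections_finite_net), and adding up the estimate over these finitely many
    sections gives mu_n f --> 0 for every continuous f (average_cvg0). *)

(** * Complemented copies from split embeddings *)

Lemma closed_equalizer (T U : topologicalType) (f g : T -> U) :
  hausdorff_space U -> continuous f -> continuous g ->
  closed [set x | f x = g x].
Proof.
move=> hU cf cg x clx; apply: hU => A B Af Bg.
have /clx[y /= [fgy [Ay By]]] : nbhs x (f @^-1` A `&` g @^-1` B).
  by apply: filterI; [exact: cf|exact: cg].
by exists (f y); split=> //; rewrite fgy.
Qed.

(** The range of T is the fixed point set of the projection T o S, hence
    closed in the Hausdorff space G. *)
Lemma complemented_copy_of_section (R : realType) (F G : tvsType R)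
    (T : F -> G) (S : G -> F) :
  hausdorff_space F -> hausdorff_space G -> linear T -> linear S ->
  continuous T -> continuous S -> cancel T S ->
  contains_complemented_copy R G F.
Proof.
(* T and S are bundled as linear maps, then renamed back. *)
move=> hF hG lT lS cT cS TK.
pose T' : {linear F -> G} := HB.pack T (GRing.isLinear.Build _ _ _ _ T lT).
pose S' : {linear G -> F} := HB.pack S (GRing.isLinear.Build _ _ _ _ S lS).
rewrite -[T]/(T' : F -> G) -[S]/(S' : G -> F) in cT cS TK.
move: T' S' cT cS TK => {lT lS} {}T {}S cT cS TK.
have cTS : continuous (T \o S).
  by move=> x; apply: continuous_comp; [exact: cS|exact: cT].
exists (range T), [set x | S x = 0]; split.
- split.
    have -> : range T = [set x | T (S x) = x].
      by apply/seteqP; split=> [_ [a _ <-]|x /= <-]; [rewrite /= TK|exists (S x)].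
    apply: (@closed_equalizer _ _ (T \o S) id hG cTS) => y; exact: cvg_id.
  split; first by rewrite inE /=; exists 0; rewrite ?linear0.
  move=> k x y /[!inE] /= -[a _ <-] [b _ <-].
  by exists (k *: a + b); rewrite ?linearP.
- split.
    apply: (@closed_equalizer _ _ S (cst 0)) => // ?; exact: cvg_cst.
  split; first by rewrite inE /= linear0.
  by move=> k x y /[!inE] /= Sx Sy; rewrite linearP Sx Sy scaler0 addr0.
- move=> x; exists (T (S x), x - T (S x)); split.
    split => /=; first by exists (S x).
      by rewrite linearB TK subrr.
    by rewrite addrCA subrr addr0.
  move=> [_ y] /= [[a _ <-] Sy ->]; rewrite linearD Sy addr0 TK.
  by rewrite addrAC subrr add0r.
- exists T, S; split => //; exact: continuous_subspaceT.
- exists (T \o S) => // x; split; first by exists (S x).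
  by rewrite /= linearB TK subrr.
Qed.

Section Ck_basics.
Context (R : realType) (Z : topologicalType).

Lemma Ck_hausdorff : hausdorff_space (Ck Z R).
Proof.
move=> f g fg; apply/continuousEP => z.
apply/eqP; rewrite -subr_eq0 -normr_eq0; apply/negP => /negP d0.
have {}d0 : 0 < `|f z - g z| / 2 by rewrite divr_gt0// lt0r d0 normr_ge0.
have nb (h : Ck Z R) : nbhs h [set k : Ck Z R | `|h z - k z| < `|f z - g z| / 2].
  apply/Ck_nbhsP; exists [set z], (`|f z - g z| / 2); split => //.
    exact: compact_set1.
  by move=> k /=; exact.
have [k [/= fk gk]] := fg _ _ (nb f) (nb g).
have := ler_distD (k z) (f z) (g z).
rewrite leNgt (splitr `|f z - g z|) => /negP; apply.
by rewrite ltrD// distrC.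
Qed.

Lemma Ck_eval_continuous (z : Z) : continuous (fun f : Ck Z R => f z : R).
Proof.
move=> f; have FF : Filter (nbhs f) by exact: nbhs_filter.
apply/cvgrPdist_lt => e e0; apply/Ck_nbhsP.
by exists [set z], e; split => //; [exact: compact_set1|move=> g /=; exact].
Qed.

End Ck_basics.

Lemma Romega_hausdorff (R : realType) : hausdorff_space (Romega R).
Proof. by apply: hausdorff_product => _; exact: Rhausdorff. Qed.

Lemma continuous_sum (R : realType) (Z : topologicalType) (I : Type) (r : seq I)
    (P : pred I) (f : I -> Z -> R) (z : Z) :
  (forall i, {for z, continuous (f i)}) ->
  {for z, continuous (fun z => \sum_(i <- r | P i) f i z)}.
Proof.
move=> cf; elim: r => [|i r ih].
  rewrite [X in {for _, continuous X}](_ : _ = cst 0); first exact: cvg_cst.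
  by apply/funext => y; rewrite big_nil.
pose g y := (if P i then f i y else 0) + \sum_(j <- r | P j) f j y.
rewrite [X in {for _, continuous X}](_ : _ = g); last first.
  by apply/funext => y; rewrite /g big_cons; case: ifP => // _; rewrite add0r.
apply: cvgD => //; case: (P i); [exact: cf|exact: cvg_cst].
Qed.

(** * Gluing functions with disjoint supports *)

Section glue.
Context (R : realType) (Z : topologicalType).
Context (phi : nat -> Z -> R).
Hypothesis phi_disj : forall m n z, phi m z != 0 -> phi n z != 0 -> m = n.

(** The index of the only term that can be nonzero at z, so that the series
    sum_n a_n phi_n(z) can be written without a limit; where all terms
    vanish, any index serves. *)
Definition active (z : Z) : nat := xget 0%N [set n | phi n z != 0].

Lemma phi_active n z : phi n z != 0 -> active z = n.
Proof.
move=> nz; apply: (phi_disj _ nz).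
by rewrite /active; case: xgetP => [m _ //|/(_ n)].
Qed.

Definition glue (a : nat -> R) (z : Z) : R := a (active z) * phi (active z) z.

Lemma glueE a n z : phi n z != 0 -> glue a z = a n * phi n z.
Proof. by move=> /phi_active; rewrite /glue => ->. Qed.

Lemma glue_sum (a : nat -> R) N z :
  \sum_(n < N) a n * phi n z = if (active z < N)%N then glue a z else 0.
Proof.
have z0 n : n != active z -> phi n z = 0.
  by move=> nz; apply/eqP; apply: contraNT nz => /phi_active ->.
case: ltnP => aN.
  rewrite (bigD1 (Ordinal aN))//= big1 ?addr0// => i.
  by rewrite -val_eqE/= => /z0 ->; rewrite mulr0.
by rewrite big1// => i _; rewrite z0 ?mulr0// neq_ltn (leq_trans _ aN).
Qed.

Hypothesis phi_cont : forall n, continuous (phi n).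

Lemma glueP (k : R) (a b : nat -> R) z :
  glue (fun n => k * a n + b n) z = k * glue a z + glue b z.
Proof. by rewrite /glue mulrDl mulrA. Qed.

(** Up to an error bounded by the tail of the series, the glued function is a
    finite sum of continuous functions; the tail only has to be small near each
    point, which covers both local finiteness and uniform convergence. *)
Lemma glue_continuous (a : nat -> R) :
  (forall (z : Z) e, 0 < e -> exists N, \forall z' \near z,
     (N <= active z')%N -> `|glue a z'| < e) ->
  continuous (glue a).
Proof.
move=> tail z; apply/cvgrPdist_lt => e e0.
have [|N Nz] := tail z (e / 3); first by rewrite divr_gt0.
pose g z := \sum_(n < N) a n * phi n z.
have gE z' : ((N <= active z')%N -> `|glue a z'| < e / 3) ->
    `|glue a z' - g z'| < e / 3.
  rewrite /g glue_sum; case: ltnP => // _; last by rewrite subr0; exact.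
  by rewrite subrr normr0 divr_gt0.
have gc : {for z, continuous g}.
  apply: continuous_sum => n; apply: cvgM; first exact: cvg_cst.
  exact: phi_cont.
have e3 : 0 < e / 3 by rewrite divr_gt0.
move/cvgrPdist_lt/(_ _ e3) : gc => gc.
have Nzz := gE _ (nbhs_singleton Nz).
near=> z'.
have z1 : `|glue a z' - g z'| < e / 3 by apply: gE; near: z'.
have z2 : `|g z - g z'| < e / 3 by near: z'.
rewrite (_ : glue a z - glue a z' =
  (glue a z - g z) + (g z - g z') - (glue a z' - g z')); last by ring.
rewrite (le_lt_trans (ler_normB _ _))//.
rewrite (le_lt_trans (lerD (ler_normD _ _) (lexx _)))//.
lra.
Unshelve. all: by end_near. Qed.

Hypothesis phi_le1 : forall n z, `|phi n z| <= 1.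

Lemma glue_le (a : nat -> R) z : `|glue a z| <= `|a (active z)|.
Proof. by rewrite normrM ler_piMr. Qed.

Section Romega_copy.
Hypothesis phi_locfin : forall z : Z, exists N, \forall z' \near z,
  forall n, (N <= n)%N -> phi n z' = 0.
Context (p : nat -> Z).
Hypothesis phip : forall n, phi n (p n) = 1.

Lemma Romega_glue_continuous (a : nat -> R) : continuous (glue a).
Proof.
apply: glue_continuous => z e e0; have [N Nz] := phi_locfin z; exists N.
by apply: filterS Nz => z' /[apply]; rewrite /glue => ->; rewrite mulr0 normr0.
Qed.

(** Local finiteness upgraded to compact sets, the form in which it controls
    the compact-open topology. *)
Lemma phi_compact_vanish (A : set Z) : compact A ->
  exists N, forall z n, A z -> (N <= n)%N -> phi n z = 0.
Proof.
move=> /compact_near_coveringP cA.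
have [z Az|N _ AN] := cA _ \oo (fun N z => forall n, (N <= n)%N -> phi n z = 0) _.
  have [N Nz] := phi_locfin z.
  exists ([set z' | forall n, (N <= n)%N -> phi n z' = 0], [set m | (N <= m)%N]).
    by split=> //=; exists N.
  by move=> [z' m] /= [Nz' Nm] n mn; apply: Nz'; exact: leq_trans mn.
by exists N => z n Az Nn; apply: (AN N) => //=.
Qed.

(** On a compact set A only finitely many phi_n are nonzero, so that finitely
    many coordinates of a control the glued function on A: this is continuity
    for the product topology. *)
Lemma complemented_Romega : contains_complemented_copy R (Ck Z R) (Romega R).
Proof.
pose T (a : Romega R) : Ck Z R := mkcts (@Romega_glue_continuous a).
pose S (f : Ck Z R) : Romega R := fun n => f (p n).
apply: (@complemented_copy_of_section _ _ _ T S).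
- exact: Romega_hausdorff.
- exact: Ck_hausdorff.
- by move=> k a b; apply/continuousEP => z; exact: glueP.
- by [].
- move=> a; have FF : Filter (nbhs a) by exact: nbhs_filter.
  move=> U /Ck_nbhsP[A [e [cA e0 AU]]].
  have [N AN] := phi_compact_vanish cA.
  have : nbhs a [set b : Romega R | forall i : 'I_N, `|a i - b i| < e].
    apply: (@filter_forall _ _
      (fun (i : 'I_N) (b : Romega R) => `|a i - b i| < e) _ FF) => i.
    have /pointwise_cvgP/(_ i)/cvgrPdist_lt/(_ _ e0)// :
      {ptws, nbhs a --> (a : nat -> R)}.
    by move=> ?.
  apply: filterS => b ab; apply: AU => z Az /=.
  rewrite /T /= [X in `|X| < _](_ : _ = glue (fun n => a n - b n) z); last first.
    by rewrite /glue mulrBl.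
  have [Na|aN] := leqP N (active z).
    by rewrite /glue (AN _ _ Az Na) mulr0 normr0.
  by rewrite (le_lt_trans (glue_le _ _))//; exact: (ab (Ordinal aN)).
- move=> f; have FF : Filter (nbhs f) by exact: nbhs_filter.
  have FS : Filter (S @ f) by exact: fmap_filter.
  by apply/(pointwise_cvgP _ FS) => n; exact: Ck_eval_continuous.
- move=> a; apply/funext => n.
  rewrite -[LHS]/(glue a (p n)) (@glueE _ n) phip ?mulr1 ?oner_neq0//.
Qed.

End Romega_copy.

Section c0_copy.
Context (A : set Z) (mu : nat -> Ck Z R -> R).
Hypothesis cA : compact A.
Hypothesis mu_linear : forall n k f g,
  mu n (k *: f + g) = k * mu n f + mu n g.
Hypothesis mu_le : forall n (f : Ck Z R) M, (forall z, A z -> `|f z| <= M) ->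
  `|mu n f| <= M.
(* This says both that mu n only sees the support of phi n and that it takes
   the value 1 on phi n; so mu n reads the coefficient a n off a glued function
   without any continuity argument. *)
Hypothesis mu_phi : forall n (f : Ck Z R) k,
  (forall z, phi n z != 0 -> f z = k * phi n z) ->
  mu n f = k.
Hypothesis mu_cvg0 : forall f, mu n f @[n --> \oo] --> 0.

Lemma c0_cvg (a : c0 R) : (a n : R) @[n --> \oo] --> (0 : R).
Proof. by have /set_mem := c0P a. Qed.

(** The partial sums converge uniformly, as the tail at z is at most
    |a (active z)|. *)
Lemma c0_glue_continuous (a : c0 R) : continuous (glue a).
Proof.
apply: glue_continuous => z e e0.
have /cvgr0Pnorm_lt/(_ _ e0)[N _ Na] := c0_cvg a.
exists N; near=> z' => Nz'; rewrite (le_lt_trans (glue_le _ _))//.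
exact: Na.
Unshelve. all: by end_near. Qed.

(** Weak* convergence of mu to 0 makes f |-> (mu n f)_n land in c_0, and the
    uniform bound mu_le makes it continuous. *)
Lemma complemented_c0 : contains_complemented_copy R (Ck Z R) (c0 R).
Proof.
pose T (a : c0 R) : Ck Z R := mkcts (@c0_glue_continuous a).
pose S (f : Ck Z R) : c0 R := C0 (mem_set (mu_cvg0 f)).
apply: (@complemented_copy_of_section _ _ _ T S).
- exact: norm_hausdorff.
- exact: Ck_hausdorff.
- by move=> k a b; apply/continuousEP => z; exact: glueP.
- by move=> k f g; apply/val_inj/funext => n; exact: mu_linear.
- move=> a; have FF : Filter (nbhs a) by exact: nbhs_filter.
  move=> U /Ck_nbhsP[B [e [cB e0 BU]]].
  have : nbhs (a : c0 R) (ball a e) by exact: nbhsx_ballx.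
  apply: filterS => b; rewrite -ball_normE /= => ab; apply: BU => z Bz.
  rewrite /T /= [X in `|X| < _](_ : _ = glue (fun n => a n - b n) z); last first.
    by rewrite /glue mulrBl.
  apply: le_lt_trans ab; rewrite (le_trans (glue_le _ _))//.
  exact: (c0_norm_ge (a - b)).
- move=> f; have FF : Filter (nbhs f) by exact: nbhs_filter.
  apply/cvgrPdist_le => e e0; apply/Ck_nbhsP; exists A, e; split => // g fg.
  apply: c0_norm_le => n.
  rewrite [X in `|X|](_ : _ = mu n ((-1) *: g + f)); last first.
    by rewrite mu_linear mulN1r addrC.
  apply: mu_le => z Az; rewrite [X in `|X|](_ : _ = f z - g z).
    exact: ltW (fg _ Az).
  by rewrite -[LHS]/(-1 * g z + f z) mulN1r addrC.
- move=> a; apply/val_inj/funext => n; apply: mu_phi => z pz.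
  exact: glueE.
Qed.

End c0_copy.
End glue.

(** * Bump functions on noncompact and on infinite spaces *)

Lemma compact_seq_cover (T : topologicalType) (K : set T) (W : T -> set T) :
  compact K -> (forall x, K x -> nbhs x (W x)) ->
  exists s : seq T, K `<=` \bigcup_(c in [set` s]) W c.
Proof.
move=> /compact_near_coveringP cK KW.
(* Finite sets of centres, directed by inclusion: near-covering along this
   filter yields a finite subcover. *)
pose F := filter_from [set: seq T] (fun s => [set t : seq T | {subset s <= t}]).
have FF : Filter F.
  apply: filter_from_filter; first by exists [::].
  move=> s t _ _; exists (s ++ t) => // u /= stu.
  by split=> x xs; apply: stu; rewrite mem_cat xs ?orbT.
have [x Kx|s _ sK] := cK _ F (fun s y => exists2 c, c \in s & W c y) FF.
  exists (W x, [set t : seq T | {subset [:: x] <= t}]).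
    by split; [exact: KW|exists [:: x]].
  by move=> [y t] /= [Wy xt]; exists x => //; apply: xt; rewrite mem_head.
by exists s => y /(sK _ (fun _ => id))[c cs Wc]; exists c.
Qed.

Lemma completely_regular_bump (R : realType) (T : topologicalType) (x : T)
    (U : set T) :
  completely_regular_space T -> open U -> U x ->
  exists f : T -> R, [/\ continuous f, forall z, `|f z| <= 1, f x = 1 &
    forall z, ~ U z -> f z = 0].
Proof.
move=> crT oU Ux.
have /(uniform_separatorP (R := R))[f [cf f01 f0 f1]] :
    uniform_separator [set x] (~` U).
  by apply: crT; [exact: open_closedC|exact].
exists (fun z => 1 - f z); split.
- by move=> z; apply: cvgB; [exact: cvg_cst|exact: cf].
- move=> z; have /f01 := imageT f z; rewrite /= in_itv /= => /andP[? ?].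
  by rewrite ler_norml; apply/andP; split; lra.
- by rewrite (f0 (f x)) ?subr0//; exists x.
- by move=> z Uz; rewrite (f1 (f z)) ?subrr//; exists z.
Qed.

Lemma compact_nbhs_compact (T : topologicalType) (K : set T) :
  locally_compact [set: T] -> compact K ->
  exists2 L, compact L & K `<=` L^°.
Proof.
move=> lc cK.
have /choice[V VP] : forall x : T, exists V : set T, nbhs x V /\ compact V.
  by move=> x; have [V] := lc x I; rewrite withinET => xV [cV _]; exists V.
have [x Kx|s sK] := compact_seq_cover (W := fun x => (V x)^°) cK.
  by apply: nbhs_interior; case: (VP x).
exists (\big[setU/set0]_(c <- s) V c).
  by apply: bigsetU_compact => c _; case: (VP c).
apply: subset_trans sK _ => y [c /= cs] Vy; apply: filterS Vy => z Vz.
by rewrite -bigcup_seq; exists c.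
Qed.

(** L (n+1) is built as a compact neighbourhood of L n, of K n and of a point
    x n outside L n, which exists because the space is not compact. *)
Lemma noncompact_exhaustion (T : topologicalType) :
  locally_compact [set: T] -> sigma_compact T -> ~ compact [set: T] ->
  exists (L : nat -> set T) (x : nat -> T),
    [/\ forall n, compact (L n), forall n, L n `<=` (L n.+1)^°,
        \bigcup_n (L n)^° = [set: T] &
        forall n, (L n.+1)^° (x n) /\ ~ L n (x n)].
Proof.
move=> lc [K [cK _ KT]] ncT.
(* A state pairs the step number with the current set, since the set K to be
   absorbed depends on the step. *)
pose P (S S' : nat * set T) := S'.1 = S.1.+1 /\ (compact S.2 ->
  [/\ compact S'.2, S.2 `|` K S.1 `<=` S'.2^° & exists2 x, S'.2^° x & ~ S.2 x]).
have next S : {S' | P S S'}.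
  apply: cid; case: S => n L; have [cL|ncL] := pselect (compact L); last first.
    by exists (n.+1, set0); split.
  have [x Lx] : exists x, ~ L x.
    apply: contrapT => /forallNP/= nL; apply: ncT.
    rewrite (_ : setT = L)//; apply/seteqP; split=> // x _.
    exact: contrapT (nL x).
  have /(compact_nbhs_compact lc)[L' cL' LL'] : compact ((L `|` K n) `|` [set x]).
    by apply: compactU; [exact: compactU|exact: compact_set1].
  exists (n.+1, L'); split=> // _; split=> //=.
    by move=> y Ly; apply: LL'; left.
  by exists x => //; apply: LL'; right.
have [S [S0 SP]] := dependent_choice next (0%N, set0).
have S1 n : (S n).1 = n.
  by elim: n => [|n ih]; [rewrite S0|rewrite (SP n).1 ih].
have cS n : compact (S n).2.
  elim: n => [|n ih]; first by rewrite S0; exact: compact0.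
  by have [_ /(_ ih)[]] := SP n.
have /choice[x xP] : forall n, exists x, (S n.+1).2^° x /\ ~ (S n).2 x.
  by move=> n; have [_ /(_ (cS n))[_ _ [x]]] := SP n; exists x.
exists (fun n => (S n).2), x; split=> //.
  move=> n y Sy; have [_ /(_ (cS n))[_ + _]] := SP n; apply; by left.
apply/seteqP; split=> // y _.
have [n _ Ky] : (\bigcup_n K n) y by rewrite KT.
exists n.+1 => //; have [_ /(_ (cS n))[_ + _]] := SP n; apply; right.
by rewrite S1.
Qed.

(** The bumps live in the disjoint open shells int (L (n+1)) minus L n; a
    neighbourhood of z inside L N meets only the first N of them. *)
Lemma noncompact_locally_finite_bumps (R : realType) (T : topologicalType) :
  tychonoff_space T ->
  locally_compact [set: T] -> sigma_compact T -> ~ compact [set: T] ->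
  exists (phi : nat -> T -> R) (x : nat -> T),
    [/\ forall m n z, phi m z != 0 -> phi n z != 0 -> m = n,
        forall n, continuous (phi n), forall n z, `|phi n z| <= 1,
        (forall z : T, exists N, \forall z' \near z,
           forall n, (N <= n)%N -> phi n z' = 0) &
        forall n, phi n (x n) = 1].
Proof.
move=> [crT hT] lc sc ncT.
have [L [x [cL LL LT xL]]] := noncompact_exhaustion lc sc ncT.
have Lmono m n : (m <= n)%N -> L m `<=` L n.
  elim: n => [|n ih]; first by rewrite leqn0 => /eqP->.
  rewrite leq_eqVlt => /predU1P[->//|]; rewrite ltnS => /ih mn y /mn /LL.
  exact: interior_subset.
have oU n : open ((L n.+1)^° `&` ~` L n).
  apply: openI; first exact: open_interior.
  by apply: closed_openC; exact: compact_closed.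
have [phi phiP] :=
  choice (fun n => completely_regular_bump R crT (oU n) (xL n)).
have phiU n z : phi n z != 0 -> L n.+1 z /\ ~ L n z.
  case: (phiP n) => _ _ _ h pz; have [[Lz nLz]|/h p0] :=
    pselect (((L n.+1)^° `&` ~` L n) z).
    by split=> //; exact: interior_subset.
  by rewrite p0 eqxx in pz.
exists phi, x; split; [|by move=> n; case: (phiP n)..| |by move=> n; case: (phiP n)].
  move=> m n z /phiU[Lm nLm] /phiU[Ln nLn].
  by apply/eqP; rewrite eqn_leq; apply/andP; split; rewrite leqNgt; apply/negP;
    move=> /Lmono; auto.
move=> z; have [N _ Nz] : (\bigcup_n (L n)^°) z by rewrite LT.
exists N; apply: filterS Nz => z' Lz n Nn; apply/eqP; apply: contrapT => /negP.
by move=> /phiU[_]; apply; exact: Lmono Lz.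
Qed.

(** Separate two points of W by disjoint open sets A and B.  If B meets W in an
    infinite set, go on there and keep the first point.  Otherwise the second
    point lies in a finite open set, so it is isolated and can be split off. *)
Lemma infinite_open_split (T : topologicalType) (W : set T) :
  hausdorff_space T -> open W -> infinite_set W ->
  exists (x : T) (U V : set T),
    [/\ open U, U x, U `<=` W, V `<=` W `\` U & open V /\ infinite_set V].
Proof.
move=> hT oW iW.
have [x Wx] := infinite_setN0 iW.
have [y [Wy yx]] : exists y, W y /\ y <> x.
  apply: contrapT => /forallNP/= nW; apply: iW.
  apply: sub_finite_set (finite_set1 x) => y Wy /=.
  by apply: contrapT => yx; exact: (nW y).
have /eqP xy := nesym yx; have := hT; rewrite open_hausdorff => /(_ _ _ xy).
move=> [[A B] /= [/set_mem Ax /set_mem By] [oA oB /eqP AB]].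
have [fB|iB] := pselect (finite_set (W `&` B)); last first.
  exists x, (W `&` A), (W `&` B); split=> //; first exact: openI.
    move=> z [Wz Bz]; split=> // -[_ Az].
    by have : (A `&` B) z by []; rewrite AB.
  by split=> //; exact: openI.
have cl1 (F : set T) : finite_set F -> closed F.
  move=> fF; exact: (accessible_finite_set_closed.1 (hausdorff_accessible hT)).
exists y, [set y], (W `\ y); split=> //.
- rewrite (_ : [set y] = (W `&` B) `\` ((W `&` B) `\ y)).
    rewrite setDE; apply: openI; first exact: openI.
    by apply: closed_openC; apply: cl1; exact: finite_setD.
  apply/seteqP; split=> [z ->|z [WBz /not_andP[//|/contrapT]]//].
  by split=> // -[_]; apply.
- by move=> z ->.
- split; first by rewrite setDE; apply: openI => //; apply: closed_openC; exact: cl1.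
  apply: infinite_setD => //; exact: finite_set1.
Qed.

(** Iterated splitting; a state consists of a point, its open neighbourhood, and
    the infinite open set that remains for the later choices. *)
Lemma infinite_disjoint_opens (T : topologicalType) :
  hausdorff_space T -> infinite_set [set: T] ->
  exists (U : nat -> set T) (x : nat -> T),
    [/\ forall n, open (U n), forall n, U n (x n) &
        forall m n z, U m z -> U n z -> m = n].
Proof.
move=> hT iT.
pose P (S S' : T * set T * set T) := open S.2 /\ infinite_set S.2 ->
  [/\ open S'.1.2, S'.1.2 S'.1.1, S'.1.2 `<=` S.2, S'.2 `<=` S.2 `\` S'.1.2 &
   open S'.2 /\ infinite_set S'.2].
have next S : {S' | P S S'}.
  apply: cid; have [[oS iS]|nS] := pselect (open S.2 /\ infinite_set S.2).
    have [x [U [V ?]]] := infinite_open_split hT oS iS.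
    by exists (x, U, V).
  by exists S.
have [x0 _] := infinite_setN0 iT.
have [S [S0 SP]] := dependent_choice next (x0, set0, setT).
have oS n : open (S n).2 /\ infinite_set (S n).2.
  by elim: n => [|n /(SP n)[]//]; rewrite S0; split => //; exact: openT.
have SW m n : (m <= n)%N -> (S n).2 `<=` (S m).2.
  elim: n => [|n ih]; first by rewrite leqn0 => /eqP->.
  rewrite leq_eqVlt => /predU1P[->//|]; rewrite ltnS => /ih mn y.
  by have [_ _ _ h _] := SP n (oS n) => /h[/mn].
have lt m n z : (m < n)%N -> (S m.+1).1.2 z -> ~ (S n.+1).1.2 z.
  move=> mn Sm Sn; have [_ _ _ h _] := SP m (oS m).
  have [_ _ /(_ _ Sn)/(SW _ _ mn)/h[_]] := SP n (oS n); exact.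
exists (fun n => (S n.+1).1.2), (fun n => (S n.+1).1.1); split.
- by move=> n; have [] := SP n (oS n).
- by move=> n; have [] := SP n (oS n).
- move=> m n z Um Un; have [/lt/(_ Um)//|/lt/(_ Un)//|//] := ltngtP m n.
Qed.

Lemma infinite_disjoint_bumps (R : realType) (T : topologicalType) :
  tychonoff_space T -> infinite_set [set: T] ->
  exists (phi : nat -> T -> R) (x : nat -> T),
    [/\ forall m n z, phi m z != 0 -> phi n z != 0 -> m = n,
        forall n, continuous (phi n), forall n z, `|phi n z| <= 1 &
        forall n, phi n (x n) = 1].
Proof.
move=> [crT hT] iT; have [U [x [oU Ux Udisj]]] := infinite_disjoint_opens hT iT.
have [phi phiP] :=
  choice (fun n => completely_regular_bump R crT (oU n) (Ux n)).
have phiU n z : phi n z != 0 -> U n z.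
  case: (phiP n) => _ _ _ h; apply: contra_neqP => /h//.
exists phi, x; split; [|by move=> n; case: (phiP n)..].
by move=> m n z /phiU Um /phiU; exact: Udisj.
Qed.

(** * Averages over sign vectors *)

Section rademacher.
Context (R : realType) (n : nat).
Implicit Types (s : {ffun 'I_n -> bool}) (h : 'I_n -> R).

Definition rademacher s (i : 'I_n) : R := (-1) ^+ s i.

Definition flip (i : 'I_n) s : {ffun 'I_n -> bool} :=
  [ffun k => (k == i) (+) s k].

Lemma flipK i : involutive (flip i).
Proof. by move=> s; apply/ffunP => k; rewrite !ffunE addbA addbb. Qed.

(** For i <> j, flipping the i-th sign is an involution of the sign vectors that
    changes the sign of each product. *)
Lemma rademacher_orthogonal i j :
  \sum_s rademacher s i * rademacher s j = (2 ^ n * (i == j))%:R.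
Proof.
have [->|ij] := eqVneq i j.
  under eq_bigr do rewrite -expr2 -exprM mulnC exprM sqrrN expr1n expr1n.
  by rewrite sumr_const card_ffun card_bool card_ord muln1.
rewrite muln0; set A := LHS.
have : A = - A.
  rewrite {1}/A (reindex_inj (inv_inj (flipK i))) /= -sumrN.
  apply: eq_bigr => s _; rewrite /rademacher !ffunE eqxx.
  by rewrite eq_sym (negbTE ij) /= signrN mulNr.
lra.
Qed.

Lemma rademacher_sum_sqr h :
  \sum_s (\sum_i rademacher s i * h i) ^+ 2 = 2 ^+ n * \sum_i h i ^+ 2.
Proof.
under eq_bigr => s _.
  rewrite expr2 mulr_suml; under eq_bigr do rewrite mulr_sumr.
  over.
rewrite exchange_big mulr_sumr; apply: eq_bigr => i _ /=.
rewrite exchange_big (bigD1 i)//= [X in _ + X]big1 => [|j ji].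
  rewrite addr0; under eq_bigr do rewrite mulrACA.
  by rewrite -mulr_suml rademacher_orthogonal eqxx muln1 natrX expr2.
under eq_bigr do rewrite mulrACA.
by rewrite -mulr_suml rademacher_orthogonal eq_sym (negbTE ji) muln0 mul0r.
Qed.

(** The L1 form of the previous identity: the mean of the absolute value of a
    signed sum of n numbers is at most the square root of n times their bound.
    The passage from squares to absolute values is the inequality between the
    arithmetic and the geometric mean, applied to each sign vector. *)
Lemma rademacher_sum_norm h M : 0 < M -> (forall i, `|h i| <= M) ->
  \sum_s `|\sum_i rademacher s i * h i| <= 2 ^+ n * (M * Num.sqrt n%:R).
Proof.
move=> M0 hM; have [n0|n0] := posnP n.
  rewrite big1 => [|s _]; first by rewrite !mulr_ge0 ?exprn_ge0 ?sqrtr_ge0 ?ltW.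
  rewrite big1 ?normr0// => i; have := ltn_ord i.
  by rewrite [X in (_ < X)%N]n0.
set l := M * Num.sqrt n%:R.
have l0 : 0 < l by rewrite mulr_gt0// sqrtr_gt0 ltr0n.
(* The weight l is the bound to be proved; it balances both terms. *)
have amgm (t : R) : `|t| <= (l + t ^+ 2 / l) / 2.
  rewrite ler_pdivlMr// -(ler_pM2r l0) [leRHS]mulrDl divfK ?gt_eqF//.
  by rewrite -(real_normK (num_real t)); have := sqr_ge0 (`|t| - l); nra.
rewrite (le_trans (ler_sum _ (fun s _ => amgm _)))//.
rewrite -mulr_suml big_split /= -[X in _ + X]mulr_suml rademacher_sum_sqr.
rewrite sumr_const card_ffun card_bool card_ord -[l *+ _]mulr_natl natrX.
rewrite ler_pdivrMr// -mulrA -mulrDr -mulrA ler_wpM2l ?exprn_ge0//.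
suff : (\sum_i h i ^+ 2) / l <= l by lra.
rewrite ler_pdivrMr// -expr2 exprMn sqr_sqrtr ?ler0n//.
have hi i : h i ^+ 2 <= M ^+ 2.
  by rewrite -(real_normK (num_real (h i))) lerXn2r ?nnegrE// ltW.
rewrite (le_trans (ler_sum _ (fun i _ => hi i)))//.
by rewrite sumr_const card_ord mulr_natr.
Qed.

End rademacher.

(** * The compact case *)

(** By compactness of Y, x |-> f(x, .) is continuous for uniform convergence on
    Y; its image is then totally bounded by compactness of X. *)
Lemma sections_finite_net (R : realType) (X Y : topologicalType)
    (f : X * Y -> R) (e : R) :
  compact [set: X] -> compact [set: Y] -> continuous f -> 0 < e ->
  exists C : seq X, forall x, exists2 c, c \in C &
    forall y, `|f (x, y) - f (c, y)| < e.
Proof.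
move=> cX /compact_near_coveringP cY cf e0.
pose W x := [set x' | forall y, `|f (x', y) - f (x, y)| < e].
have [x _|C CX] := compact_seq_cover (W := W) cX; last first.
  by exists C => x; have [c] := CX x I; exists c.
suff near_x y : [set: Y] y ->
    \forall y' \near y & x' \near x, `|f (x', y') - f (x, y')| < e.
  have := cY X (nbhs x) (fun x' y' => `|f (x', y') - f (x, y')| < e)
    (nbhs_filter x) near_x.
  by apply: filterS => x' + y; exact.
move=> _; have e2 : 0 < e / 2 by rewrite divr_gt0.
have /cvgrPdist_lt/(_ _ e2)[[A B] /= [xA yB] AB] := cf (x, y).
exists (B, A) => // -[y' x'] /= [By' Ax'].
have h1 := AB (x', y') (conj Ax' By').
have h2 := AB (x, y') (conj (nbhs_singleton xA) By').
rewrite /= (_ : _ - _ = (f (x, y) - f (x, y')) - (f (x, y) - f (x', y'))); last by ring.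
by rewrite (le_lt_trans (ler_normB _ _))// (splitr e) ltrD.
Qed.

Lemma norm_sum_disjoint (R : realType) (I : finType) (F : I -> R) :
  (forall i, `|F i| <= 1) -> (forall i j, F i != 0 -> F j != 0 -> i = j) ->
  `|\sum_i F i| <= 1.
Proof.
move=> F1 Fd; have [/existsP[i Fi]|/existsPn F0] := boolP [exists i, F i != 0].
  rewrite (bigD1 i)//= big1 ?addr0// => j ji; apply/eqP.
  by apply: contraNT ji => /(Fd _ _ Fi) ->.
by rewrite big1 ?normr0// => i _; apply/eqP; rewrite -[_ == _]negbK F0.
Qed.

Section rademacher_blocks.
Context (R : realType) (X Y : topologicalType).
Context (phi : nat -> X -> R) (x : nat -> X) (psi : nat -> Y -> R) (y : nat -> Y).
Hypothesis phi_disj : forall m n z, phi m z != 0 -> phi n z != 0 -> m = n.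
Hypothesis psi_disj : forall m n z, psi m z != 0 -> psi n z != 0 -> m = n.
Hypothesis phi_cont : forall n, continuous (phi n).
Hypothesis psi_cont : forall n, continuous (psi n).
Hypothesis phi_le1 : forall n z, `|phi n z| <= 1.
Hypothesis psi_le1 : forall n z, `|psi n z| <= 1.
Hypothesis phix : forall n, phi n (x n) = 1.
Hypothesis psiy : forall n, psi n (y n) = 1.

Definition cell n : finType := ({ffun 'I_n.+1 -> bool} * 'I_n.+1)%type.

(** The points x_(n,s) := x (code s) of all levels n have to be distinct, so
    levels and sign vectors are numbered together; the points y_i serve all
    levels. *)
Definition code n (s : {ffun 'I_n.+1 -> bool}) : nat :=
  pickle (Tagged (fun n => {ffun 'I_n.+1 -> bool}) s).

Lemma code_level m n s t : @code m s = @code n t -> m = n.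
Proof. by move=> st; have /(congr1 tag) := pcan_inj (@pickleK _) st. Qed.

Lemma code_inj n : injective (@code n).
Proof. by move=> s t st; exact: eq_from_Tagged (pcan_inj (@pickleK _) st). Qed.

(** The function phi_n of the overview: its value at (x_(n,s), y_i) is the sign
    s_i.  Level n uses sign vectors of length n + 1, to avoid empty averages. *)
Definition block n (z : X * Y) : R := \sum_(p : cell n)
  rademacher R p.1 p.2 * (phi (code p.1) z.1 * psi p.2 z.2).

Definition average n (f : X * Y -> R) : R :=
  (\sum_(p : cell n) rademacher R p.1 p.2 * f (x (code p.1), y p.2)) /
  (2 ^+ n.+1 * n.+1%:R).

Let rademacher_neq0 n s i : @rademacher R n s i != 0.
Proof. by rewrite signr_eq0. Qed.

Let norm_rademacher n s i : `|@rademacher R n s i| = 1.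
Proof. exact: normr_sign. Qed.

Let phixE m n : phi m (x n) = (m == n)%:R.
Proof.
have [->//|mn] := eqVneq m n; apply/eqP; apply: contraNT mn => mn.
by apply/eqP/(phi_disj mn); rewrite phix oner_neq0.
Qed.

Let psiyE m n : psi m (y n) = (m == n)%:R.
Proof.
have [->//|mn] := eqVneq m n; apply/eqP; apply: contraNT mn => mn.
by apply/eqP/(psi_disj mn); rewrite psiy oner_neq0.
Qed.

Let term_neq0 n (p : cell n) z :
  rademacher R p.1 p.2 * (phi (code p.1) z.1 * psi p.2 z.2) != 0 ->
  phi (code p.1) z.1 != 0 /\ psi p.2 z.2 != 0.
Proof. by rewrite !mulf_eq0 !negb_or => /and3P[]. Qed.

Lemma block_neq0 n z : block n z != 0 ->
  exists s : {ffun 'I_n.+1 -> bool}, phi (code s) z.1 != 0.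
Proof.
move=> nz; have [/existsP[s]|/existsPn phi0] :=
  boolP [exists s : {ffun 'I_n.+1 -> bool}, phi (code s) z.1 != 0].
  by exists s.
move: nz; rewrite /block big1 ?eqxx// => p _.
by have /negPn/eqP -> := phi0 p.1; rewrite mul0r mulr0.
Qed.

Lemma block_disj m n z : block m z != 0 -> block n z != 0 -> m = n.
Proof.
move=> /block_neq0[s sz] /block_neq0[t tz].
exact: code_level (phi_disj sz tz).
Qed.

Lemma block_continuous n : continuous (block n).
Proof.
move=> z; apply: continuous_sum => p; apply: cvgM; first exact: cvg_cst.
apply: cvgM.
  by apply: (continuous_comp (f := fst)); [exact: cvg_fst|exact: phi_cont].
by apply: (continuous_comp (f := snd)); [exact: cvg_snd|exact: psi_cont].
Qed.

Lemma block_le1 n z : `|block n z| <= 1.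
Proof.
apply: norm_sum_disjoint => [p|[s i] [t j]].
  by rewrite normrM norm_rademacher mul1r normrM mulr_ile1.
move=> /(@term_neq0 n (s, i) z)[/= sz iz] /(@term_neq0 n (t, j) z)[/= tz jz].
by rewrite (code_inj (phi_disj sz tz)) (val_inj (psi_disj iz jz)).
Qed.

Lemma block_point n (p : cell n) :
  block n (x (code p.1), y p.2) = rademacher R p.1 p.2.
Proof.
rewrite /block (bigD1 p)//= phixE psiyE !eqxx mulr1 mulr1 big1 ?addr0//.
move=> [s i] /= sip; rewrite phixE psiyE.
have [/code_inj sp|] := eqVneq; last by rewrite mul0r mulr0.
have [/val_inj ip|] := eqVneq; last by rewrite mulr0 mulr0.
by move: sip; rewrite sp ip -surjective_pairing eqxx.
Qed.

Let weight_gt0 n : 0 < 2 ^+ n.+1 * n.+1%:R :> R.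
Proof. by rewrite mulr_gt0 ?exprn_gt0. Qed.

Let card_cell n : #|{: cell n}|%:R = 2 ^+ n.+1 * n.+1%:R :> R.
Proof.
by rewrite card_prod card_ffun card_bool card_ord natrM natrX.
Qed.

Lemma average_linear n k f g :
  average n (fun z => k * f z + g z) = k * average n f + average n g.
Proof.
rewrite /average mulrA -mulrDl mulr_sumr -big_split /=; congr (_ / _).
by apply: eq_bigr => p _; rewrite mulrDr mulrCA.
Qed.

Lemma average_le n f M : (forall z, `|f z| <= M) -> `|average n f| <= M.
Proof.
move=> fM; rewrite normrM normfV (gtr0_norm (weight_gt0 n)) ler_pdivrMr//.
rewrite (le_trans (ler_norm_sum _ _ _))//.
have le_M (p : cell n) :
    `|rademacher R p.1 p.2 * f (x (code p.1), y p.2)| <= M.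
  by rewrite normrM norm_rademacher mul1r.
rewrite (le_trans (ler_sum _ (fun p _ => le_M p)))//.
by rewrite sumr_const -[M *+ _]mulr_natr card_cell.
Qed.

(** At the points that carry the average, f is k times a sign, and this sign
    is squared away. *)
Lemma average_block n f k :
  (forall z, block n z != 0 -> f z = k * block n z) -> average n f = k.
Proof.
move=> fk; rewrite /average; apply: (canLR (mulfK _)); first by rewrite gt_eqF.
rewrite -card_cell mulr_natr -sumr_const; apply: eq_bigr => p _.
rewrite fk block_point // mulrCA -expr2 -[X in k * X]real_normK ?num_real//.
by rewrite norm_rademacher expr1n mulr1.
Qed.

(** Replacing the section at each x_(n,s) by one within e of it costs e; which
    of the sections indexed by C is used depends on s, so all of them are added
    up to obtain a bound to which the estimate for sign averages applies. *)
Lemma average_le_net n f C e M : 0 < e -> 0 < M -> (forall z, `|f z| <= M) ->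
  (forall u, exists2 c, c \in C & forall v, `|f (u, v) - f (c, v)| < e) ->
  `|average n f| <= e + (size C)%:R * M / Num.sqrt n.+1%:R.
Proof.
move=> e0 M0 fM fC.
pose r (s : {ffun 'I_n.+1 -> bool}) (u : X) : R :=
  \sum_i rademacher R s i * f (u, y i).
have r_net s u : `|r s u| <= n.+1%:R * e + \sum_(c <- C) `|r s c|.
  have [c cC uc] := fC u.
  have : `|r s u - r s c| <= n.+1%:R * e.
    rewrite /r -sumrB (le_trans (ler_norm_sum _ _ _))//.
    have le_e (i : 'I_n.+1) :
        `|rademacher R s i * f (u, y i) - rademacher R s i * f (c, y i)| <= e.
      by rewrite -mulrBr normrM norm_rademacher mul1r ltW.
    rewrite (le_trans (ler_sum _ (fun i _ => le_e i)))//.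
    by rewrite sumr_const card_ord mulr_natl.
  have : `|r s c| <= \sum_(c <- C) `|r s c|.
    by rewrite (big_rem c)//= lerDl sumr_ge0.
  by have := ler_normD (r s u - r s c) (r s c); rewrite subrK; lra.
have sqN : Num.sqrt n.+1%:R * Num.sqrt n.+1%:R = n.+1%:R :> R.
  by rewrite -expr2 sqr_sqrtr ?ler0n.
have sq0 : 0 < Num.sqrt n.+1%:R :> R by rewrite sqrtr_gt0.
rewrite normrM normfV (gtr0_norm (weight_gt0 n)) ler_pdivrMr//.
rewrite -(pair_bigA _ (fun s i => rademacher R s i * f (x (code s), y i)))/=.
rewrite (le_trans (ler_norm_sum _ _ _))//.
rewrite (le_trans (ler_sum _ (fun s _ => r_net s (x (code s)))))//.
rewrite big_split /= exchange_big /= sumr_const card_ffun card_bool card_ord.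
have r_c c : \sum_s `|r s c| <= 2 ^+ n.+1 * (M * Num.sqrt n.+1%:R).
  exact: rademacher_sum_norm.
rewrite (le_trans (lerD (lexx _) (ler_sum _ (fun c _ => r_c c))))//.
rewrite big_const_seq count_predT iter_addr_0.
rewrite -[_ *+ size C]mulr_natl -[_ *+ (2 ^ _)]mulr_natl natrX.
rewrite le_eqVlt; apply/orP; left; apply/eqP.
rewrite mulrDl; congr (_ + _); first by ring.
move: sqN sq0; set q := Num.sqrt _ => <- q0; rewrite mulrCA [RHS]mulrCA.
by congr (_ * _); field; rewrite gt_eqF.
Qed.

Hypothesis cX : compact [set: X].
Hypothesis cY : compact [set: Y].

(** For fixed e the finite net C does not depend on n, so the second term of
    average_le_net tends to 0. *)
Lemma average_cvg0 f : continuous f -> average n f @[n --> \oo] --> (0 : R).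
Proof.
move=> cf; have cXY : compact [set: X * Y] by rewrite -setXTT; exact: compact_setX.
have [M M0 fM] : exists2 M, 0 < M & forall z, `|f z| <= M.
  have /compact_bounded[M [_ fM]] :=
    continuous_compact (continuous_subspaceT cf) cXY.
  exists (`|M| + 1) => [|z]; first by rewrite ltr_wpDl.
  by apply: fM; [rewrite (le_lt_trans (ler_norm _))// ltrDl|exists z].
apply/cvgr0Pnorm_le => e e0; have e2 : 0 < e / 2 by rewrite divr_gt0.
have [C fC] := sections_finite_net cX cY cf e2.
near=> n; rewrite (le_trans (average_le_net n e2 M0 fM fC))//.
set K := (size C)%:R * M.
have K0 : 0 <= K by rewrite mulr_ge0// ltW.
rewrite [leRHS]splitr lerD2l ler_pdivrMr ?sqrtr_gt0//.
have v0 : 0 <= (e / 2)^-1 * K by rewrite mulr_ge0// invr_ge0 ltW.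
rewrite -ler_pdivrMl// -(ger0_norm v0) -sqrtr_sqr ler_wsqrtr//.
suff : ((e / 2)^-1 * K) ^+ 2 <= n%:R.
  by move=> /le_trans; apply; rewrite ler_nat.
by near: n; exact: nbhs_infty_ger.
Unshelve. all: by end_near. Qed.

Lemma compact_complemented_c0 :
  contains_complemented_copy R (Ck (X * Y)%type R) (c0 R).
Proof.
apply: (@complemented_c0 _ _ block block_disj block_continuous block_le1 setT
  (fun n f => average n f)).
- by rewrite -setXTT; exact: compact_setX.
- by move=> n k f g; exact: average_linear.
- by move=> n f M fM; apply: average_le => z; exact: fM.
- by move=> n f k; exact: average_block.
- by move=> f; apply: average_cvg0; exact: cts_fun.
Qed.

End rademacher_blocks.

(** * The dichotomy *)

Theorem corollary6p7 (R : realType) (X Y : topologicalType)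
    (tychonoffX : tychonoff_space X) (tychonoffY : tychonoff_space Y)
    (infiniteX : infinite_set [set: X]) (infiniteY : infinite_set [set: Y])
    (locally_compactX : locally_compact [set: X])
    (locally_compactY : locally_compact [set: Y])
    (sigma_compactX : sigma_compact X) (sigma_compactY : sigma_compact Y) :
  contains_complemented_copy R (Ck (X * Y)%type R) (Romega R) \/
  contains_complemented_copy R (Ck (X * Y)%type R) (c0 R).
Proof.
have [cX|ncX] := pselect (compact [set: X]); last first.
  left; have [phi [x [disj cont le1 fin phix]]] :=
    noncompact_locally_finite_bumps R tychonoffX locally_compactX
      sigma_compactX ncX.
  have [y _] := infinite_setN0 infiniteY.
  apply: (@complemented_Romega _ _ (fun n (z : X * Y) => phi n z.1) _ _ _ _
    (fun n => (x n, y))) => //.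
  - by move=> m n z; exact: disj.
  - move=> n z; apply: (continuous_comp (f := fst)); first exact: cvg_fst.
    exact: cont.
  - move=> z; have [N Nz] := fin z.1; exists N.
    exact: (cvg_fst Nz).
have [cY|ncY] := pselect (compact [set: Y]); last first.
  left; have [psi [y [disj cont le1 fin psiy]]] :=
    noncompact_locally_finite_bumps R tychonoffY locally_compactY
      sigma_compactY ncY.
  have [x _] := infinite_setN0 infiniteX.
  apply: (@complemented_Romega _ _ (fun n (z : X * Y) => psi n z.2) _ _ _ _
    (fun n => (x, y n))) => //.
  - by move=> m n z; exact: disj.
  - move=> n z; apply: (continuous_comp (f := snd)); first exact: cvg_snd.
    exact: cont.
  - move=> z; have [N Nz] := fin z.2; exists N.
    exact: (cvg_snd Nz).
right; have [phi [x [phid phic phi1 phix]]] :=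
  infinite_disjoint_bumps R tychonoffX infiniteX.
have [psi [y [psid psic psi1 psiy]]] :=
  infinite_disjoint_bumps R tychonoffY infiniteY.
exact: (compact_complemented_c0 phid psid phic psic phi1 psi1 phix psiy).
Qed.
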